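(* Assume that $\mathrm{cov}(s_0)=\mathfrak{c}$ and that $\mathfrak{c}$ is a regular cardinal. Let $\mathcal{A}\subseteq s_0$ be a big-point family of subsets of the real line $\mathbb{R}$ such that for all $x,y\in\mathbb{R}$ with $x\neq y$, $$|\{A\in\mathcal{A}: x,y\in A\}|<\mathfrak{c}.$$ Then there exists a subfamily $\mathcal{A}'\subseteq\mathcal{A}$ such that $\bigcup\mathcal{A}'$ is completely $s$-nonmeasurable.
   Context: $\mathfrak{c}=2^{\aleph_0}$. $\mathrm{Perf}(\mathbb{R})$ denotes the set of all nonempty perfect subsets of $\mathbb{R}$ (closed, without isolated points). The Marczewski ideal $s_0$ on $\mathbb{R}$ consists of all $A\subseteq \mathbb{R}$ such that for every $P\in \mathrm{Perf}(\mathbb{R})$ there is $Q\in \mathrm{Perf}(\mathbb{R})$ with $Q\subseteq P$ and $Q\cap A=\emptyset$. $\mathrm{cov}(s_0)=\min\{|\mathcal{F}|: \mathcal{F}\subseteq s_0\text{ and }\bigcup\mathcal{F}=\mathbb{R}\}$. A family $\mathcal{A}$ of subsets of $\mathbb{R}$ is a big-point family if $\{x\in \mathbb{R}: |\{A\in\mathcal{A}: x\in A\}|<\mathfrak{c}\}\in s_0$. A set $A\subseteq \mathbb{R}$ is completely $s$-nonmeasurable if for every $P\in \mathrm{Perf}(\mathbb{R})$ both $P\cap A\neq\emptyset$ and $P\cap(\mathbb{R}\setminus A)\neq\emptyset$. *)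

(* Defs.v *)
From HB Require Import structures.
From mathcomp Require Import all_boot all_order all_algebra.
From mathcomp Require Import all_classical all_reals all_analysis.
From mathcomp Require wochoice.

Set Implicit Arguments.
Unset Strict Implicit.
Unset Printing Implicit Defensive.

Import numFieldNormedType.Exports.

Local Open Scope classical_set_scope.
Local Open Scope card_scope.

Definition card_lt (T U : Type) (A : set T) (B : set U) : Prop :=
  A #<= B /\ ~ (A #= B).
Notation "A '#<' B" := (card_lt A B)
  (at level 79, format "A  '#<'  B") : card_scope.

(* Cardinals are represented by sets up to [#=]; this one is 2 ^ aleph_0. *)
Definition continuum : set (set nat) := [set: set nat].

(* [le] well-orders [T] in the order type of the initial ordinal of the
   cardinal |T|: every proper initial segment has cardinality less than |T|.
   Such an order exists on every [T], and is unique up to isomorphism. *)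
Definition initial_well_order (T : Type) (le : rel T) : Prop :=
  wochoice.well_order le /\ forall x : T, [set y | le y x /\ y <> x] #< [set: T].

Definition cofinal (T : Type) (le : rel T) (C : set T) : Prop :=
  forall x : T, exists2 y, C y & le x y.

(* |T| is infinite and equal to its own cofinality.  Cofinal subsets of the
   ordinal |T| have cardinality at most |T|, so cf |T| = |T| says that they all
   have cardinality exactly |T|. *)
Definition regular_cardinal (T : Type) : Prop :=
  infinite_set [set: T] /\
  forall le : rel T, initial_well_order le ->
    forall C : set T, cofinal le C -> C #= [set: T].

Definition Perf (R : realType) : set (set R) :=
  [set P | P !=set0 /\ perfect_set P].

Definition s0 (R : realType) : set (set R) :=
  [set A | forall P, Perf P ->
     exists Q, [/\ Perf Q, Q `<=` P & Q `&` A = set0]].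

Definition s0_cover (R : realType) (F : set (set R)) : Prop :=
  F `<=` @s0 R /\ \bigcup_(A in F) A = [set: R].

(* cov(s0) = |K|, where cov(s0) is the least cardinality of an [s0_cover]. *)
Definition cov_s0_eq (R : realType) (T : Type) (K : set T) : Prop :=
  (exists2 F : set (set R), s0_cover F & F #= K) /\
  (forall F : set (set R), s0_cover F -> K #<= F).

Definition big_point_family (R : realType) (F : set (set R)) : Prop :=
  s0 [set x : R | [set A | F A /\ A x] #< continuum].

Definition completely_s_nonmeasurable (R : realType) (A : set R) : Prop :=
  forall P, Perf P -> P `&` A !=set0 /\ P `&` ~` A !=set0.

(* Main.v *)
Require Import Defs.
From HB Require Import structures.
From mathcomp Require Import all_boot all_order all_algebra.
From mathcomp Require Import all_classical all_reals all_analysis.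
From mathcomp Require Import lra.
From mathcomp Require wochoice.

(** The subfamily is built by transfinite recursion.  Code the perfect sets of
    reals by the elements of [set nat], and well-order [set nat] in order type
    c, so that every proper initial segment has size less than c.  At stage [a],
    with [P] the perfect set coded by [a], choose a set [A a] of the family and
    a point [d a] such that
    - [A a] meets [P] and contains no earlier point [d b];
    - [d a] lies in [P], outside [A a] and outside every earlier [A b].
    In the end no [d a] lies in any [A b], so the union of the sets [A a] meets
    every perfect set and so does its complement.

    Two facts make a stage possible.

    - No perfect set [P] is covered by fewer than c sets of [s0]
      ([Perf_not_covered]).  The hypothesis on cov(s0) says this for the whole
      line; it is transferred to [P] by a map from the line into [P] under which
      preimages of [s0] sets are [s0] ([s0_reducing_map]).  The map sends a real
      to its cut in a countable dense set, a point of the Cantor space, followed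
      by an embedding of the Cantor space into [P].
    - By regularity, a union of fewer than c sets, each of size less than c, has
      size less than c ([regular_bigcup_card_lt]).

    Since the family is big-point, [P] has a perfect subset whose points all lie
    in at least c members of the family.  The first fact, applied to that subset
    and to the singletons of the earlier points, gives such a point [x] different
    from every earlier [d b].  For each of them, fewer than c members contain
    both [x] and [d b]; by the second fact some member through [x] avoids them
    all, and this is [A a].  Being in [s0], it misses a perfect subset of [P],
    and the first fact, applied to this subset and the earlier [A b], gives
    [d a]. *)

Set Implicit Arguments.
Unset Strict Implicit.
Unset Printing Implicit Defensive.

Import Order.TTheory GRing.Theory Num.Theory numFieldNormedType.Exports.

Local Open Scope classical_set_scope.
Local Open Scope card_scope.

(** * Cardinals and initial well-orders *)

Lemma card_le_lt_trans (T U V : Type) (A : set T) (B : set U) (C : set V) :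
  A #<= B -> B #< C -> A #< C.
Proof.
move=> AB [BC nBC]; split; first exact: card_le_trans BC.
move=> /card_eqPle[_ CA]; apply: nBC; apply/card_eqPle; split=> //.
exact: card_le_trans AB.
Qed.

Lemma card_le_injP (T U : pointedType) (A : set T) (B : set U) :
  A #<= B <-> exists f : T -> U, {in A &, injective f} /\ f @` A `<=` B.
Proof.
split=> [/pcard_leP/unsquash f|[f [fI fAB]]].
  by exists f; split=> [|_ [x Ax <-]]; [exact: inj|exact: funS].
apply: card_le_trans (subset_card_le fAB).
by have /card_eqPle[] := inj_card_eq fI.
Qed.

Section WellOrder.
Variables (T : Type) (le : rel T).
Hypothesis wo : wochoice.well_order le.

Definition strict (y x : T) : Prop := le y x /\ y <> x.

Lemma well_order_min (A : set T) : A !=set0 ->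
  exists2 z, A z & forall x, A x -> le z x.
Proof.
move=> [a Aa]; have [|z [[zA lez] _]] := @wo [pred x | `[<A x>]].
  by exists a; rewrite inE.
exists z; first by move: zA; rewrite inE.
by move=> x Ax; apply: lez; rewrite inE.
Qed.

Lemma well_order_total x y : le x y \/ le y x.
Proof.
have [|z + lez] := @well_order_min [set x; y]; first by exists x; left.
by case=> /= ez; subst z; [left; apply: lez; right|right; apply: lez; left].
Qed.

Lemma well_order_anti x y : le x y -> le y x -> x = y.
Proof.
have refl z : le z z by have [] := well_order_total z z.
move=> xy yx; have [|z [_ zU]] := @wo [pred z | `[<z = x \/ z = y>]].
  by exists x; rewrite inE; left.
have zx : z = x by apply: zU; split=> [|t]; rewrite inE; [left|case=> ->].
have zy : z = y by apply: zU; split=> [|t]; rewrite inE; [right|case=> ->].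
by rewrite -zx.
Qed.

Lemma not_le_strict x y : ~ le x y -> strict y x.
Proof.
move=> nxy; case: (well_order_total x y) => // yx; split=> // eyx.
by apply: nxy; move: yx; rewrite eyx.
Qed.

Lemma strict_not_le x y : strict y x -> ~ le x y.
Proof. by move=> [yx nyx] xy; apply: nyx; apply: well_order_anti. Qed.

Lemma strict_wf : well_founded strict.
Proof.
move=> a; apply: contrapT => na.
have [|z nz lez] := @well_order_min [set x | ~ Acc strict x]; first by exists a.
apply: nz; constructor=> y zy; apply: contrapT => /lez.
exact: strict_not_le.
Qed.

End WellOrder.

(** Start from any well-order.  If some proper initial segment is as large as
    [T], take the least [m] whose segment is: pulling the order back along an
    injection of [T] into the segment below [m] gives a well-order whose
    segments embed in segments below points smaller than [m]. *)
Lemma initial_well_order_exists (T : pointedType) :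
  exists le : rel T, initial_well_order le.
Proof.
have [le wo] := wochoice.well_ordering_principle T.
have [small|/existsNP[x0 x0big]] :=
  pselect (forall x, [set y | strict le y x] #< [set: T]).
  by exists le.
pose big := [set x | [set: T] #<= [set y | strict le y x]].
have bigP x : ~ ([set y | strict le y x] #< [set: T]) -> big x.
  move=> nx; rewrite /big/=; apply: contrapT => ns; apply: nx.
  split; first exact: card_leT.
  by move=> /card_eqPle[_ ?]; exact: ns.
have [|m mbig minm] := well_order_min wo (A := big); first by exists x0; exact: bigP.
have [f [fI fm]] := (card_le_injP _ _).1 mbig.
have finj : injective f by move=> x y; apply: fI; rewrite inE.
exists (fun x y => le (f x) (f y)); split.
  apply: wochoice.antisymmetric_well_order.
    by move=> x y /andP[xy yx]; apply: finj; apply: (well_order_anti wo).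
  move=> A [a aA].
  have [|z [b bA <-] lez] := well_order_min wo (A := f @` [set x | x \in A]).
    by exists (f a); exists a.
  by exists b; split=> // x xA; apply: lez; exists x.
move=> x; apply: (@card_le_lt_trans _ _ _ _ [set y | strict le y (f x)]).
  apply/card_le_injP; exists f; split=> [y z _ _|]; first exact: finj.
  by move=> _ [y [yx nyx] <-]; split=> // /finj.
apply: contrapT => /bigP /minm mfx; apply: (strict_not_le wo _ mfx).
by apply: fm; exists x.
Qed.

(** [Phi] is what a stage asks of its choice alone, [Psi] what it asks relative
    to the choice of each earlier stage; separating the two lets the step
    hypothesis rely on the earlier choices only through [Phi]. *)
Lemma transfinite_choice (T : Type) (lt : T -> T -> Prop) (X : pointedType)
  (Phi : T -> X -> Prop) (Psi : X -> X -> Prop) :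
  well_founded lt ->
  (forall a (g : T -> X), (forall b, lt b a -> Phi b (g b)) ->
    exists x, Phi a x /\ forall b, lt b a -> Psi (g b) x) ->
  exists g : T -> X, (forall a, Phi a (g a)) /\
    forall a b, lt b a -> Psi (g b) (g a).
Proof.
move=> wf step.
(* [xget] takes [point] when no suitable choice exists; the induction below shows
   that this never happens. *)
pose body a (rec : forall b, lt b a -> X) : X :=
  xget point [set x | Phi a x /\ forall b (h : lt b a), Psi (rec b h) x].
pose g := Fix wf (fun _ => X) body.
pose ok a := [set x | Phi a x /\ forall b, lt b a -> Psi (g b) x].
have gE a : g a = xget point (ok a).
  rewrite /g Fix_eq// => x u v uv; congr body.
  by apply/functional_extensionality_dep => y;
    apply/functional_extensionality_dep => h.
have gP a : ok a (g a).
  elim/(well_founded_ind wf): a => a IH; rewrite [g a]gE.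
  have [x xP] := step a g (fun b h => (IH b h).1).
  exact: xgetI xP.
by exists g; split=> a; [exact: (gP a).1|exact: (gP a).2].
Qed.

(** The inequality c * c <= c. *)
Lemma set_nat_pairing :
  exists p : set nat -> set nat -> set nat,
    forall A B C D, p A B = p C D -> A = C /\ B = D.
Proof.
exists (fun A B => [set n | if odd n then A n./2 else B n./2]) => // A B C D pE.
split; apply/funext => n.
  by have := congr1 (fun S : set nat => S n.*2.+1) pE; rewrite /= odd_double uphalf_double.
by have := congr1 (fun S : set nat => S n.*2) pE; rewrite /= odd_double doubleK.
Qed.

(** By c * c <= c the union has size at most c.  Were it c, the [S i] would cover
    the ordinal c by fewer than c pieces, each of size less than c.
    Regularity makes each piece bounded, and then the set of these bounds
    bounded too, so that the whole ordinal would have a strict upper bound. *)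
Lemma regular_bigcup_card_lt (X : pointedType) (I : set (set nat))
    (S : set nat -> set X) :
  regular_cardinal (set nat) -> I #< [set: set nat] ->
  (forall i, I i -> S i #< [set: set nat]) ->
  \bigcup_(i in I) S i #< [set: set nat].
Proof.
move=> [_ reg] Ilt Slt.
have [p pI] := set_nat_pairing.
have /choice[g gP] i :
    exists g : X -> set nat, I i -> {in S i &, injective g}.
  have [Ii|nIi] := pselect (I i); last by exists point.
  by have [/card_le_injP[g [gI _]] _] := Slt i Ii; exists g.
have /choice[k kP] x :
    exists i, (\bigcup_(i in I) S i) x -> I i /\ S i x.
  have [[i Ii Six]|nx] := pselect ((\bigcup_(i in I) S i) x); first by exists i.
  by exists point.
split.
  (* [x] is coded by the index [k x] of a piece and its code in that piece. *)
  apply/card_le_injP; exists (fun x => p (k x) (g (k x) x)); split=> //.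
  move=> x y; rewrite !inE => /kP[Ikx Skx] /kP[Iky Sky] /pI[kxy].
  by rewrite -kxy in Iky Sky *; apply: gP => //; rewrite inE.
move=> /card_eqPle[_ /card_le_injP[b [bI bS]]].
have [le [wo leinit]] := initial_well_order_exists (set nat).
have bounded (C : set (set nat)) : C #< [set: set nat] ->
    exists t, forall y, C y -> strict le y t.
  move=> [_ nC]; apply: contrapT => nb; apply: nC; apply: (reg le) => // t.
  apply: contrapT => nt; apply: nb; exists t => y Cy.
  by apply: (not_le_strict wo) => ty; apply: nt; exists y.
have /choice[t tP] i :
    exists t, I i -> forall y, S i (b y) -> strict le y t.
  have [Ii|nIi] := pselect (I i); last by exists point.
  have [|t tP] := bounded [set y | S i (b y)]; last by exists t => _.
  apply: card_le_lt_trans (Slt i Ii); apply/card_le_injP; exists b; split.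
    by move=> x y _ _; apply: bI; rewrite inE.
  by move=> _ [y Sy <-].
have [|u uP] := bounded (t @` I).
  by apply: card_le_lt_trans Ilt; apply: card_image_le.
have [|i Ii Siu] := bS (b u); first by exists u.
apply: (strict_not_le wo (tP i Ii u Siu)).
by have [] := uP (t i) (ex_intro2 _ _ i Ii erefl).
Qed.

(** * Perfect sets and the Cantor space *)

Lemma perfect_setE (T : topologicalType) (A : set T) :
  perfect_set A <-> closed A /\ A `<=` limit_point A.
Proof.
split=> [[cA lA]|[cA lA]]; split=> //; first by rewrite lA.
apply/seteqP; split=> //; apply: subset_trans (@subset_limit_point _ A) _.
by rewrite -(closure_id A).1.
Qed.

Section InjectionOfCompact.
Variables (X Y : topologicalType) (f : X -> Y).
Hypotheses (cptX : compact [set: X]) (hsY : hausdorff_space Y).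
Hypotheses (cf : continuous f) (injf : injective f).

Lemma closed_image_compact (A : set X) : closed A -> closed (f @` A).
Proof.
move=> clA; apply: compact_closed => //; apply: continuous_compact.
  exact: continuous_subspaceT.
exact: subclosed_compact clA cptX _.
Qed.

Lemma perfect_image (A : set X) : perfect_set A -> perfect_set (f @` A).
Proof.
move=> /perfect_setE[clA limA]; apply/perfect_setE; split.
  exact: closed_image_compact.
move=> _ [x Ax <-] U fxU; have [y [yx Ay Uy]] := limA x Ax _ (@cf x U fxU).
exists (f y); split=> //.
by apply: contra_neq yx => /injf.
Qed.

(** Injectivity on a compact space makes the inverse of [f] continuous on the
    range, so limit points can be lifted: away from an open [V] around [x] the
    image of [f] is closed and omits [f x]. *)
Lemma perfect_preimage (B : set Y) :
  B `<=` range f -> perfect_set B -> perfect_set (f @^-1` B).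
Proof.
move=> Bf /perfect_setE[clB limB]; apply/perfect_setE; split.
  by apply: preimage_closed => // x; exact: cf.
move=> x Bfx U; rewrite nbhsE => -[V [oV Vx] VU].
have clfV : closed (f @` ~` V).
  by apply: closed_image_compact; rewrite closedC.
have [|y [yfx By fVy]] := limB _ Bfx (~` (f @` ~` V)).
  apply: open_nbhs_nbhs; split; first by rewrite openC.
  by move=> [z nVz /injf zx]; apply: nVz; rewrite zx.
have [z _ zy] := Bf _ By; exists z; split.
- by apply: contra_neq yfx => <-.
- by rewrite /= zy.
- by apply: VU; apply: contrapT => nVz; apply: fVy; exists z.
Qed.

End InjectionOfCompact.

Lemma near_cantor_coord (x : cantor_space) (i : nat) : \forall y \near x, y i = x i.
Proof.
exact: (@proj_continuous nat (fun=> bool) i x [set x i] (discrete_set1 _)).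
Qed.

Lemma near_cantor_prefix (x : cantor_space) (n : nat) :
  \forall y \near x, forall i, (i < n)%N -> y i = x i.
Proof.
have F : Filter (nbhs x) by exact: nbhs_filter.
elim: n => [|n IH]; first by apply: (@filterE _ (nbhs x)).
apply: (@filterS2 _ (nbhs x) F _ _ _ _ IH (near_cantor_coord x n)).
move=> y yn yi i; rewrite ltnS leq_eqVlt => /predU1P[->//|]; exact: yn.
Qed.

Lemma continuous_to_cantor (X : topologicalType) (f : X -> cantor_space) :
  (forall x i, \forall y \near x, f y i = f x i) -> continuous f.
Proof.
move=> fP x; apply/cvg_sup => i; apply/cvg_image.
  by rewrite eqEsubset; split => b //= _; exists (fun=> b).
move=> A /= Ax; exists [set y : cantor_space | A (y i)].
  rewrite /nbhs/=; near=> y; rewrite /= (near (fP x i) y)//.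
  exact: nbhs_singleton.
rewrite eqEsubset; split => [_ [y Ay <-]//|b Ab].
by exists (fun=> b).
Unshelve. all: by end_near. Qed.

(** * Cantor sets inside perfect sets of reals *)

Local Open Scope ring_scope.

(** The intervals [c n - r n, c n + r n] are nested, with lengths at least halved
    at each step; they shrink to a single point. *)
Section NestedIntervals.
Variables (R : realType) (c r : nat -> R).
Hypotheses (r_gt0 : forall n, 0 < r n) (r_half : forall n, r n.+1 <= r n / 2).
Hypothesis nested : forall n, `|c n - c n.+1| + r n.+1 <= r n.

Lemma radius_lt (e : R) : 0 < e -> exists n, r n < e.
Proof.
move=> e0; have r_le n : r n <= r 0%N * (1 / 2 ^+ n).
  elim: n => [|n IH]; first by rewrite expr0 divr1 mulr1.
  apply: le_trans (r_half n) _.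
  by rewrite exprSr invfM mulrA mulrA ler_wpM2r ?invr_ge0// -mulrA.
have [n _ /(_ n)] := near_infty_natSinv_expn_lt (PosNum (divr_gt0 e0 (r_gt0 0%N))).
move=> /(_ (leqnn n))/= nlt; exists n; apply: le_lt_trans (r_le n) _.
by rewrite mulrC -ltr_pdivlMr.
Qed.

Lemma nested_le m n : c m - r m <= c n + r n.
Proof.
have step k : c k - r k <= c k.+1 - r k.+1 /\ c k.+1 + r k.+1 <= c k + r k.
  have := nested k; have := ler_norm (c k - c k.+1).
  by have := ler_norm (c k.+1 - c k); rewrite distrC; split; lra.
have lo : nondecreasing_seq (fun k => c k - r k).
  by apply/nondecreasing_seqP => k; exact: (step k).1.
have hi : nonincreasing_seq (fun k => c k + r k).
  by apply/nonincreasing_seqP => k; exact: (step k).2.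
have := lo m (maxn m n) (leq_maxl _ _); have := hi n (maxn m n) (leq_maxr _ _).
have := r_gt0 (maxn m n); lra.
Qed.

Definition nested_point : R := sup (range (fun n => c n - r n)).

Lemma nested_pointP n : `|nested_point - c n| <= r n.
Proof.
rewrite ler_distl; apply/andP; split.
  apply: ub_le_sup; last by exists n.
  by exists (c 0%N + r 0%N) => _ [k _ <-]; exact: nested_le.
by apply: ge_sup => [|_ [k _ <-]]; [exists (c 0%N - r 0%N); exists 0%N|exact: nested_le].
Qed.

End NestedIntervals.

(** A Cantor scheme: a node is a centre in [P] with a radius.  As the centre is
    not isolated, the ball around it contains a second point of [P], and the two
    children are disjoint balls of equal radius around these two points, inside
    the parent ball.  A branch converges to the point common to its balls. *)
Lemma cantor_embedding (R : realType) (P : set R) : Perf P ->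
  exists e : cantor_space -> R, [/\ continuous e, injective e & range e `<=` P].
Proof.
move=> [[c0 Pc0] /perfect_setE[clP limP]].
(* [sp] gives the second centre and the common radius of the children, a third of
   the distance between the two centres. *)
have /choice[sp spP] (s : R * R) : exists s' : R * R, P s.1 -> 0 < s.2 ->
    [/\ P s'.1, 0 < s'.2, s'.2 <= s.2 / 2, `|s.1 - s'.1| + s'.2 <= s.2 &
        2 * s'.2 < `|s.1 - s'.1|].
  case: s => c r /=; have [[Pc r0]|n] := pselect (P c /\ 0 < r); last first.
    by exists (c, r) => Pc r0; case: n.
  have [|c' [c'c Pc' cr']] := limP c Pc (ball c (r / 2)).
    by apply: nbhsx_ballx; lra.
  have d0 : 0 < `|c - c'| by rewrite normr_gt0 subr_eq0 eq_sym.
  by move: cr'; rewrite /ball/= => cr'; exists (c', `|c - c'| / 3) => _ _; split=> //=; lra.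
pose step (b : bool) s := if b then sp s else (s.1, (sp s).2).
pose node := fix node (x : cantor_space) n : R * R :=
  if n is m.+1 then step (x m) (node x m) else (c0, 1).
have nodeP x n : P (node x n).1 /\ 0 < (node x n).2.
  elim: n => //= n [Pn rn]; have [? ? _ _ _] := spP _ Pn rn.
  by rewrite /step; case: (x n).
have half x n : (node x n.+1).2 <= (node x n).2 / 2.
  have [Pn rn] := nodeP x n; have [_ _ ? _ _] := spP _ Pn rn.
  by rewrite /= /step; case: (x n).
have nested x n :
    `|(node x n).1 - (node x n.+1).1| + (node x n.+1).2 <= (node x n).2.
  have [Pn rn] := nodeP x n; have [_ ? ? ? _] := spP _ Pn rn.
  by rewrite /= /step; case: (x n) => //=; rewrite subrr normr0; lra.
pose e x := nested_point (fun n => (node x n).1) (fun n => (node x n).2).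
have eP x n : `|e x - (node x n).1| <= (node x n).2.
  by apply: (@nested_pointP R (fun n => (node x n).1) (fun n => (node x n).2)) => k;
    [exact: (nodeP x k).2|exact: nested].
have small x eps : 0 < eps -> exists n, (node x n).2 < eps.
  by apply: (@radius_lt R (fun n => (node x n).2)) => k; [exact: (nodeP x k).2|exact: half].
have agree x y n : (forall i, (i < n)%N -> y i = x i) -> node y n = node x n.
  elim: n => //= n IH xy; rewrite IH ?xy// => i ltin.
  by apply: xy; exact: ltnW.
exists e; split.
- move=> x; apply/cvgrPdist_lt => eps eps0.
  have [|n nlt] := small x (eps / 2); first by rewrite divr_gt0.
  apply: (@filterS _ (nbhs x) (nbhs_filter x) _ _ _ (near_cantor_prefix x n)).
  move=> y /agree yx; have := eP y n; rewrite yx distrC => ey.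
  have ex := eP x n; have := ler_distD (node x n).1 (e x) (e y); lra.
- move=> x y exy; apply: contrapT => nxy.
  have [n] : exists n, x n != y n.
    apply: contrapT => n; apply: nxy; apply/funext => k.
    by apply/eqP; apply: contrapT => /negP xyk; apply: n; exists k.
  (* At the least [n] where they differ, [x] and [y] enter disjoint balls. *)
  elim/ltn_ind: n => n IH xyn.
  have [[m [mn xym]]|nm] := pselect (exists m, (m < n)%N /\ x m != y m).
    exact: IH xym.
  have nE : node y n = node x n.
    apply: agree => i ltin; apply/eqP; apply: contrapT => /negP yxi.
    by apply: nm; exists i; rewrite eq_sym.
  have [Pn rn] := nodeP x n; have [_ r0 _ _ far] := spP _ Pn rn.
  have := eP x n.+1; have := eP y n.+1; rewrite /= /step nE exy => {nE}.
  have tri (u v t : R) : `|u - v| <= `|t - v| + `|t - u|.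
    by rewrite [leRHS]addrC [`|t - u|]distrC; exact: ler_distD.
  by case: (x n) (y n) xyn => -[] //= _ e1 e2;
    have := tri (node x n).1 (sp (node x n)).1 (e y); lra.
- move=> _ [x _ <-]; rewrite (closure_id P).1// => U /nbhs_ballP[eps /= eps0 epsU].
  have [n nlt] := small x eps eps0; exists (node x n).1; split.
    exact: (nodeP x n).1.
  by apply: epsU; rewrite /ball/=; apply: le_lt_trans nlt.
Qed.

Section CantorSubsets.
Variable R : realType.
Implicit Types (P Q A : set R) (e : cantor_space -> R).

Lemma Perf_image_cantor e (C : set cantor_space) :
  continuous e -> injective e -> C !=set0 -> perfect_set C -> Perf (e @` C).
Proof.
move=> ce ie [x Cx] pC; split; first by exists (e x); exists x.
by apply: perfect_image pC => //; exact: cantor_space_compact.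
Qed.

Lemma Perf_range_cantor e : continuous e -> injective e -> Perf (range e).
Proof.
move=> ce ie; apply: Perf_image_cantor => //; last exact: cantor_perfect.
by exists point.
Qed.

(** Interleaving splits the Cantor space into perfect slices, one for each
    sequence [y] of odd coordinates.  By injectivity, a value [d n] of the
    embedding [e] has only one preimage, and [y] is chosen by diagonalization to
    differ from its odd coordinates at place [n]; the slice of [y] then avoids
    every [d n]. *)
Lemma cantor_embedding_avoiding P (d : nat -> R) : Perf P ->
  exists e, [/\ continuous e, injective e, range e `<=` P &
                forall x n, e x <> d n].
Proof.
move=> /cantor_embedding[e [ce ie eP]].
pose weave (x y : cantor_space) : cantor_space :=
  fun n => if odd n then y n./2 else x n./2.
have /choice[y yP] n : exists b : bool, forall z, e z = d n -> b != z n.*2.+1.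
  have [[z ez]|nz] := pselect (exists z, e z = d n).
    by exists (~~ z n.*2.+1) => z'; rewrite -ez => /ie ->; case: (z _).
  by exists true => z ez; case: nz; exists z.
have weave_odd x n : weave x y n.*2.+1 = y n.
  by rewrite /weave /= odd_double /= uphalf_double.
have weave_even x n : weave x y n.*2 = x n.
  by rewrite /weave odd_double doubleK.
exists (fun x => e (weave x y)); split.
- move=> x; apply: (@continuous_comp _ _ _ (weave^~ y) e); last exact: ce.
  apply: continuous_to_cantor => {}x i; rewrite /weave.
  case: ifP => _; first exact: (@filterE _ (nbhs x) (nbhs_filter x)).
  exact: near_cantor_coord.
- move=> x x' /ie xx'; apply/funext => n.
  by rewrite -[LHS]weave_even xx' weave_even.
- by move=> _ [x _ <-]; apply: eP; exists (weave x y).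
- by move=> x n /yP; rewrite weave_odd eqxx.
Qed.

(** * Transfer of the covering number to perfect sets *)

Lemma s0_set1 (x : R) : s0 [set x].
Proof.
move=> P /(cantor_embedding_avoiding (fun=> x))[e [ce ie eP ex]].
exists (range e); split=> //; first exact: Perf_range_cantor.
by rewrite -subset0 => _ [[z _ <-] /(ex z 0%N)].
Qed.

(** The map [f] need only be tame on a small part of each perfect set: a Cantor
    subset of [Q] on which [f] is a homeomorphism carries [s0] sets back. *)
Lemma s0_preimage (f : R -> R) :
  (forall Q, Perf Q -> exists e, [/\ continuous e, injective e, range e `<=` Q,
     continuous (f \o e) & injective (f \o e)]) ->
  forall A, s0 A -> s0 (f @^-1` A).
Proof.
move=> fP A sA Q /fP[e [ce ie eQ cfe ife]].
have [K [[[y Ky] pK] Kfe KA]] := sA _ (Perf_range_cantor cfe ife).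
exists (e @` ((f \o e) @^-1` K)); split.
- apply: Perf_image_cantor => //.
    by have [z _ zy] := Kfe _ Ky; exists z; rewrite /preimage/= -[f _]/((f \o e) z) zy.
  apply: perfect_preimage pK => //; exact: cantor_space_compact.
- by move=> _ [z _ <-]; apply: eQ; exists z.
- rewrite -subset0 => _ [[z Kz <-] Az].
  by have : (K `&` A) (f (e z)) by []; rewrite KA.
Qed.

Lemma dense_sequence :
  exists d : nat -> R, forall x y, x < y -> exists n, x < d n /\ d n < y.
Proof.
exists (fun n => if unpickle n is Some q then ratr q else 0) => x y.
move=> /rat_in_itvoo[q]; rewrite in_itv/= => /andP[xq qy].
by exists (pickle q); rewrite pickleK.
Qed.

(** The map is [e \o cut], where [e] embeds the Cantor space in [P] and [cut]
    sends a real to its cut in the dense sequence [d].  The cut map is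
    injective, and continuous off the range of [d]; since every perfect set
    contains a Cantor set that avoids this range, [s0_preimage] applies. *)
Lemma s0_reducing_map P : Perf P ->
  exists f : R -> R, (forall x, P (f x)) /\ (forall A, s0 A -> s0 (f @^-1` A)).
Proof.
move=> /cantor_embedding[e [ce ie eP]].
have [d dense] := dense_sequence.
pose cut (x : R) : cantor_space := fun n => d n < x.
have cut_inj : injective cut.
  have lt x y : x < y -> cut x <> cut y.
    move=> /dense[n [xn ny]] /(congr1 (fun z => z n)); rewrite /cut ny.
    by move/(lt_trans xn); rewrite ltxx.
  move=> x y xy; have [/lt|/lt|//] := ltgtP x y; first by [].
  by move=> /(_ (esym xy)).
exists (e \o cut); split=> [x|]; first by apply: eP; exists (cut x).
apply: s0_preimage => Q /(cantor_embedding_avoiding d)[u [cu iu uQ ud]].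
exists u; split=> //; last by move=> x y /ie/cut_inj/iu.
have ccu : continuous (cut \o u).
  apply: continuous_to_cantor => x n; rewrite /cut/=.
  have [lt|gt|/ud//] := ltgtP (u x) (d n).
    have := cu x _ (open_nbhs_nbhs (conj (@open_lt _ (d n)) lt)).
    apply: (@filterS _ (nbhs x) (nbhs_filter x)) => z /= zlt.
    by apply/negbTE; rewrite -leNgt ltW.
  have := cu x _ (open_nbhs_nbhs (conj (@open_gt _ (d n)) gt)).
  by apply: (@filterS _ (nbhs x) (nbhs_filter x)) => z /= ->.
by move=> x; apply: (@continuous_comp _ _ _ (cut \o u) e); [exact: ccu|exact: ce].
Qed.

(** The preimages, under the map of [s0_reducing_map], of sets covering [P] cover
    the line, so there are at least c of them. *)
Lemma Perf_not_covered P (G : set (set R)) :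
  cov_s0_eq R continuum -> Perf P -> G `<=` @s0 R -> G #< continuum ->
  exists x, P x /\ forall A, G A -> ~ A x.
Proof.
move=> [_ cov] /s0_reducing_map[f [fP fs0]] Gs0 Glt.
apply: contrapT => nx.
have : [set f @^-1` A | A in G] #< continuum.
  by apply: card_le_lt_trans Glt; exact: card_image_le.
case=> le; apply; apply/card_eqPle; split=> //; apply: cov; split.
  by move=> _ [A /Gs0 sA <-]; exact: fs0.
apply/seteqP; split=> // x _; apply: contrapT => xG; apply: nx.
exists (f x); split=> // A GA Afx; apply: xG.
by exists (f @^-1` A) => //; exists A.
Qed.

(** A closed set is coded by the intervals with endpoints in a dense sequence
    that miss it. *)
Lemma closed_coding :
  exists code : set nat -> set R, forall P, closed P -> exists S, code S = P.
Proof.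
have [d dense] := dense_sequence.
exists (fun S => [set x | forall i j, S (pickle (i, j)) -> ~ (d i < x /\ x < d j)]).
move=> P clP.
exists [set k | forall i j, k = pickle (i, j) -> forall x, d i < x /\ x < d j -> ~ P x].
apply/seteqP; split=> x /=; last by move=> Px i j /(_ i j erefl x) h /h.
move=> xP; apply: contrapT => nPx.
have : nbhs x (~` P) by apply: open_nbhs_nbhs; split=> //; exact: closed_openC.
move=> /nbhs_ballP[r /= r0 rP].
have [i [xi ix]] := dense (x - r) x ltac:(by rewrite ltrBlDr ltrDl).
have [j [xj jx]] := dense x (x + r) ltac:(by rewrite ltrDl).
apply: (xP i j) => // i' j' /(pcan_inj pickleK)[<- <-] z [iz zj]; apply: rP.
by rewrite /ball/= ltr_distl; apply/andP; split; lra.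
Qed.

End CantorSubsets.

(** * The transfinite construction *)

Theorem theorem3p1 (R : realType)
  (cov_continuum : cov_s0_eq R continuum)
  (continuum_regular : regular_cardinal (set nat))
  (F : set (set R))
  (F_s0 : F `<=` @s0 R)
  (F_big : big_point_family F)
  (F_pairs : forall x y : R, x <> y ->
     [set A | F A /\ A x /\ A y] #< continuum) :
  exists F' : set (set R),
    F' `<=` F /\ completely_s_nonmeasurable (\bigcup_(A in F') A).
Proof.
have [[P0 pP0]|noPerf] := pselect (exists P : set R, Perf P); last first.
  by exists set0; split=> // P pP; case: noPerf; exists P.
have [le [wo small]] := initial_well_order_exists (set nat).
(* [Pf] enumerates the perfect sets; codes of other sets are sent to [P0]. *)
have [code codeP] := closed_coding R.
pose Pf a := if pselect (Perf (code a)) then code a else P0.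
have PfP a : Perf (Pf a) by rewrite /Pf; case: pselect.
have Pf_onto P : Perf P -> exists a, Pf a = P.
  move=> pP; have [a aP] := codeP P pP.2.1; exists a.
  by rewrite /Pf; case: pselect => //; rewrite aP.
pose Phi a (x : set R * R) :=
  [/\ F x.1, Pf a `&` x.1 !=set0, Pf a x.2 & ~ x.1 x.2].
pose Psi (x y : set R * R) := ~ y.1 x.2 /\ ~ x.1 y.2.
have [|g [gPhi gPsi]] := transfinite_choice (Phi := Phi) (Psi := Psi) (strict_wf wo).
  move=> a g gP; pose I := [set b | strict le b a].
  have Ilt : I #< [set: set nat] := small a.
  have few T (h : set nat -> T) : h @` I #< continuum.
    by apply: card_le_lt_trans Ilt; exact: card_image_le.
  have [Q [pQ QP QB]] := F_big _ (PfP a).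
  have [|x [Qx xd]] :=
      Perf_not_covered cov_continuum pQ _ (few _ (fun b => [set (g b).2])).
    by move=> _ [b _ <-]; exact: s0_set1.
  (* [x] lies in at least c members of [F], of which fewer than c are [bad]. *)
  pose bad := \bigcup_(b in I) [set A | F A /\ A x /\ A (g b).2].
  have badlt : bad #< continuum.
    apply: regular_bigcup_card_lt => // b Ib; apply: F_pairs => xb.
    by apply: (xd [set (g b).2]) => //; exists b.
  have [A [FA Ax nbad]] : exists A, [/\ F A, A x & ~ bad A].
    apply: contrapT => nA.
    suff : (Q `&` [set x | [set A | F A /\ A x] #< continuum]) x by rewrite QB.
    split=> //=; apply: card_le_lt_trans badlt; apply: subset_card_le => A [FA Ax].
    by apply: contrapT => nb; apply: nA; exists A.
  (* The point [y] is sought in [Q'], which [A] misses, so that only the sets of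
     earlier stages have to be avoided. *)
  have [Q' [pQ' Q'P Q'A]] := F_s0 _ FA _ (PfP a).
  have [|y [Q'y yd]] :=
      Perf_not_covered cov_continuum pQ' _ (few _ (fun b => (g b).1)).
    by move=> _ [b Ib <-]; have [/F_s0] := gP b Ib.
  exists (A, y); split=> [|b ba]; split=> //=.
  - by exists x; split=> //; exact: QP.
  - exact: Q'P.
  - by move=> Ay; have : (Q' `&` A) y by []; rewrite Q'A.
  - by move=> Ab; apply: nbad; exists b.
  - by apply: yd; exists b.
exists [set (g a).1 | a in setT]; split; first by move=> _ [a _ <-]; have [] := gPhi a.
move=> P /Pf_onto[a <-]; have [_ [x [Px Ax]] Pd nAd] := gPhi a; split.
  by exists x; split=> //; exists (g a).1 => //; exists a.
exists (g a).2; split=> // -[_ [b _ <-] Abd].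
have [ab|nab] := pselect (le a b); last first.
  by have [] := gPsi a b (not_le_strict wo nab).
have [ab'|nab'] := pselect (a = b); first by apply: nAd; rewrite {1}ab'.
by have [] := gPsi b a (conj ab nab').
Qed.
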